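(* Let $\Gamma$ be a finitely generated torsion-free 2-step nilpotent group of rank $n$. Then there exists a faithful representation $\varrho:\Gamma\to\mathrm{Iso}(\mathbb{R}^{2n}_n)$ such that $M=\mathbb{R}^{2n}_n/\varrho(\Gamma)$ is a complete flat pseudo-Riemannian homogeneous manifold of signature $(n,n)$ with abelian linear holonomy group.
   Context: $\mathbb{R}^{2n}_n$ denotes $\mathbb{R}^{2n}$ with a non-degenerate symmetric bilinear form of signature $(n,n)$, and $\mathrm{Iso}(\mathbb{R}^{2n}_n)$ is its group of (affine) isometries. A group $\Gamma$ is 2-step nilpotent if $[\Gamma,[\Gamma,\Gamma]]$ is trivial. The rank of a finitely generated torsion-free nilpotent group is its Hirsch length, equivalently the dimension of its real Malcev hull. ''Complete flat pseudo-Riemannian homogeneous manifold'' means: $\varrho(\Gamma)$ acts freely and properly discontinuously on $\mathbb{R}^{2n}_n$, so that the quotient $M$ is a geodesically complete flat pseudo-Riemannian manifold, and the isometry group of $M$ acts transitively on $M$. The linear holonomy group is $\mathrm{Hol}(\varrho(\Gamma))=\{I+A\mid (I+A,v)\in\varrho(\Gamma)\}$, the group of linear parts of the affine maps $(I+A,v)$ (linear part $I+A$, translation part $v$) in $\varrho(\Gamma)$. *)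

(* Defs.v *)
From HB Require Import structures.
From mathcomp Require Import all_boot all_order all_algebra.
From mathcomp Require Import all_classical all_reals all_analysis.

Set Implicit Arguments.
Unset Strict Implicit.
Unset Printing Implicit Defensive.

Import Order.TTheory GRing.Theory Num.Theory.
Import numFieldNormedType.Exports.

Local Open Scope classical_set_scope.
Local Open Scope ring_scope.

Section InfiniteGroups.
Variable G : groupType.
Implicit Types (H K S : set G).

Definition is_subgroup H : Prop :=
  [/\ H 1%g, forall x y, H x -> H y -> H (x * y)%g
    & forall x, H x -> H (x^-1)%g].

Definition generated S : set G := smallest is_subgroup S.

Definition commutator_subgroup H K : set G :=
  generated [set x | exists h k, [/\ H h, K k & x = [~ h, k]%g]].

Definition finitely_generated : Prop :=
  exists S, finite_set S /\ generated S = setT.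

Definition torsion_free : Prop :=
  forall (x : G) (k : nat), (0 < k)%N -> (x ^+ k)%g = 1%g -> x = 1%g.

Definition two_step_nilpotent : Prop :=
  commutator_subgroup setT (commutator_subgroup setT setT) = [set 1%g].

Definition normal_in K H : Prop :=
  K `<=` H /\ forall x y, K x -> H y -> K (x ^ y)%g.

(* The two predicates below concern the quotient H / K, for K normal in H. *)
Definition cyclic_factor K H : Prop :=
  exists2 g, H g & H = generated ([set g] `|` K).

Definition infinite_factor K H : Prop :=
  infinite_set [set [set (x * k)%g | k in K] | x in H].

(* n is the number of infinite factors in a subnormal series with cyclic
   factors; by Schreier refinement it does not depend on the series. *)
Definition has_hirsch_length (n : nat) : Prop :=
  exists (m : nat) (H : nat -> set G),
    [/\ H 0%N = [set 1%g],
        H m = setT,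
        (forall i, (i < m)%N ->
           [/\ is_subgroup (H i), normal_in (H i) (H i.+1)
             & cyclic_factor (H i) (H i.+1)])
      & n = (\sum_(i < m) `[< infinite_factor (H i) (H i.+1) >])%N].

End InfiniteGroups.

Section Forms.
Variables (R : realType).

(* The columns of P form an orthogonal basis with p vectors of square 1
   followed by q vectors of square -1. *)
Definition has_signature (p q : nat) (B : 'M[R]_(p + q)) : Prop :=
  [/\ B^T = B, B \in unitmx
    & exists2 P : 'M[R]_(p + q), P \in unitmx &
        P^T *m B *m P = block_mx 1%:M 0 0 (- 1%:M)].

Definition form (d : nat) (B : 'M[R]_d) (u v : 'cV[R]_d) : R :=
  (u^T *m B *m v) 0 0.

End Forms.

Section AffineIsometries.
Variables (R : realType) (d : nat) (B : 'M[R]_d).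

Definition preserves_form (A : 'M[R]_d) : bool :=
  (A \in unitmx) && (A^T *m B *m A == B).

(* The pair (A, v) stands for the affine map x |-> A x + v. *)
Record affine_isometry := AffineIsometry {
  affine_pair : 'M[R]_d * 'cV[R]_d;
  _ : preserves_form affine_pair.1
}.

HB.instance Definition _ := [isSub for affine_pair].
HB.instance Definition _ := [Choice of affine_isometry by <:].

Implicit Types f g : affine_isometry.

Definition linear_part f : 'M[R]_d := (affine_pair f).1.
Definition translation_part f : 'cV[R]_d := (affine_pair f).2.
Definition affine_map f (x : 'cV[R]_d) : 'cV[R]_d :=
  linear_part f *m x + translation_part f.

Lemma linear_partP f : preserves_form (linear_part f).
Proof. exact: valP f. Qed.

Lemma linear_part_unit f : linear_part f \in unitmx.
Proof. by case/andP: (linear_partP f). Qed.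

Lemma linear_part_form f : (linear_part f)^T *m B *m linear_part f = B.
Proof. by case/andP: (linear_partP f) => _ /eqP. Qed.

Fact isom_one_subproof : preserves_form (1%:M, 0 : 'cV[R]_d).1.
Proof. by rewrite /preserves_form /= unitmx1 trmx1 mul1mx mulmx1 eqxx. Qed.

Fact isom_mul_subproof f g :
  preserves_form (linear_part f *m linear_part g,
    linear_part f *m translation_part g + translation_part f).1.
Proof.
rewrite /preserves_form /= unitmx_mul !linear_part_unit trmx_mul /=.
by rewrite -!mulmxA (mulmxA B) (mulmxA _^T (B *m _)) (mulmxA _^T B)
           linear_part_form mulmxA linear_part_form.
Qed.

Fact isom_inv_subproof f :
  preserves_form (invmx (linear_part f),
    - (invmx (linear_part f) *m translation_part f)).1.
Proof.
have uA := linear_part_unit f.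
rewrite /preserves_form /= unitmx_inv uA /=; apply/eqP.
rewrite -{1}(linear_part_form f) !mulmxA -trmx_mul mulmxV // trmx1 mul1mx.
by rewrite -mulmxA mulmxV // mulmx1.
Qed.

Definition isom_one := AffineIsometry isom_one_subproof.
Definition isom_mul f g := AffineIsometry (isom_mul_subproof f g).
Definition isom_inv f := AffineIsometry (isom_inv_subproof f).

Lemma affine_isometry_eq f g :
  linear_part f = linear_part g -> translation_part f = translation_part g ->
  f = g.
Proof. by move=> e1 e2; apply/val_inj; apply: injective_projections. Qed.

Fact isom_mulA : associative isom_mul.
Proof.
move=> f g h; apply: affine_isometry_eq; rewrite /linear_part /translation_part /=.
  exact: mulmxA.
by rewrite mulmxDr mulmxA addrA.
Qed.

Fact isom_mul1 : left_id isom_one isom_mul.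
Proof.
move=> f; apply: affine_isometry_eq; rewrite /linear_part /translation_part /=;
by rewrite mul1mx ?addr0.
Qed.

Fact isom_1mul : right_id isom_one isom_mul.
Proof.
move=> f; apply: affine_isometry_eq; rewrite /linear_part /translation_part /=.
  by rewrite mulmx1.
by rewrite mulmx0 add0r.
Qed.

Fact isom_mulV : left_inverse isom_one isom_inv isom_mul.
Proof.
move=> f; have uA := linear_part_unit f.
apply: affine_isometry_eq; rewrite /linear_part /translation_part /=.
  exact: mulVmx.
exact: subrr.
Qed.

Fact isom_Vmul : right_inverse isom_one isom_inv isom_mul.
Proof.
move=> f; have uA := linear_part_unit f.
apply: affine_isometry_eq; rewrite /linear_part /translation_part /=.
  exact: mulmxV.
by rewrite mulmxN mulmxA mulmxV // mul1mx addNr.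
Qed.

HB.instance Definition _ := isGroup.Build affine_isometry
  isom_mulA isom_mul1 isom_1mul isom_mulV isom_Vmul.

Lemma affine_map1 x : affine_map 1%g x = x.
Proof. by rewrite /affine_map /linear_part /translation_part /= mul1mx addr0. Qed.

Lemma affine_mapM f g x : affine_map (f * g)%g x = affine_map f (affine_map g x).
Proof.
by rewrite /affine_map /linear_part /translation_part /= mulmxDr mulmxA addrA.
Qed.

End AffineIsometries.

Section Smooth.
Variables (R : realType) (V W : normedModType R).

(* F is of class C^k on the open set U; for V of finite dimension, as here,
   it is enough to iterate directional derivatives. *)
Fixpoint class_C (k : nat) (U : set V) (F : V -> W) : Prop :=
  match k with
  | 0%N => forall x, U x -> {for x, continuous F}
  | k'.+1 => (forall x, U x -> differentiable F x)
             /\ forall v, class_C k' U ('D_v F)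
  end.

Definition smooth_on (U : set V) (F : V -> W) : Prop :=
  forall k, class_C k U F.

End Smooth.

Section Quotient.
Variables (R : realType) (d : nat) (B : 'M[R]_d) (G : groupType).
Variable rho : {multiplicative G -> affine_isometry B}.
Local Notation V := 'cV[R]_d.

Fact rho1 : rho 1%g = 1%g.
Proof. by apply: (@mulgI _ (rho 1%g)); rewrite -gmulfM !mulg1. Qed.

Definition acts_freely : Prop :=
  forall f x, range rho f -> affine_map f x = x -> f = 1%g.

Definition acts_properly_discontinuously : Prop :=
  forall K : set V, compact K ->
    finite_set [set f | range rho f /\ (affine_map f @` K) `&` K !=set0].

Definition linear_holonomy : set 'M[R]_d := @linear_part R d B @` range rho.

Definition abelian_holonomy : Prop :=
  forall A A', linear_holonomy A -> linear_holonomy A' -> A *m A' = A' *m A.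

Definition orbit_rel (x y : V) : bool :=
  `[< exists g : G, affine_map (rho g) x = y >].

Fact orbit_rel_equiv : equiv_class_of orbit_rel.
Proof.
split=> [x | x y | y x z].
- by apply/asboolP; exists 1%g; rewrite rho1 affine_map1.
- by apply/asboolP/asboolP => -[g <-]; exists (g^-1)%g;
     rewrite -affine_mapM -gmulfM mulVg rho1 affine_map1.
- move=> /asboolP[g <-] /asboolP[h <-]; apply/asboolP; exists (h * g)%g.
  by rewrite gmulfM affine_mapM.
Qed.

Canonical orbit_equiv_rel := EquivRelPack orbit_rel_equiv.

Definition orbit_space : Type := {eq_quot orbit_rel}%qT.

Definition orbit_proj (x : V) : orbit_space := (\pi_{eq_quot orbit_rel} x)%qT.

(* When rho(G) acts freely and properly discontinuously, orbit_proj is a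
   covering map, and orbit_space carries the unique smooth structure and
   pseudo-Riemannian metric for which it is a local isometry from the space
   with constant metric B.  Reading phi in the charts given by local sections
   of orbit_proj, phi is smooth and preserves the metric if and only if it is
   induced near every point x by a smooth map F whose differentials preserve
   B. *)
Definition preserves_metric (phi : orbit_space -> orbit_space) : Prop :=
  forall x : V, exists (U : set V) (F : V -> V),
    [/\ open U, U x, smooth_on U F,
        forall u, U u -> orbit_proj (F u) = phi (orbit_proj u)
      & forall u a b, U u -> form B ('d F u a) ('d F u b) = form B a b].

Definition quotient_isometry (phi : orbit_space -> orbit_space) : Prop :=
  preserves_metric phi /\
  exists psi, [/\ cancel phi psi, cancel psi phi & preserves_metric psi].

Definition homogeneous_quotient : Prop :=
  forall p q : orbit_space, exists2 phi, quotient_isometry phi & phi p = q.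

(* Completeness and flatness need no further clause: the geodesics of the
   quotient are the images of the affine lines. *)
Definition complete_flat_homogeneous : Prop :=
  [/\ acts_freely, acts_properly_discontinuously & homogeneous_quotient].

End Quotient.

(* Main.v *)
(* The logarithm embeds G in its Malcev Lie algebra, of dimension n and nilpotent
   of step two.  The semidirect product of this Lie algebra with its dual, under
   the coadjoint action, carries the invariant pairing form, of signature (n, n),
   and is again nilpotent of step two.  In logarithmic coordinates the left and
   the right translations of its simply connected group are therefore affine
   isometries, with linear parts 1 + ad / 2 and 1 - ad / 2; G acts by left
   translations, and the right translations, which commute with them, act
   simply transitively.

   The dual of the Malcev Lie algebra is the space of functions f on G
   with f (xy) = f x + f y + f [x, y] / 2.  A basis is obtained by extending such
   functions along a chain of isolated subgroups; the chain is not longer than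
   the Hirsch length, because the number of factors of the given series in which
   a subgroup has an element of infinite order grows at each step. *)

From HB Require Import structures.
Require Import Defs.
From mathcomp Require Import all_boot all_order all_algebra.
From mathcomp Require Import all_classical all_reals all_analysis.
From mathcomp Require Import zify ring lra.

Set Implicit Arguments.
Unset Strict Implicit.
Unset Printing Implicit Defensive.

Import Order.TTheory GRing.Theory Num.Theory.
Import numFieldNormedType.Exports.
Local Open Scope classical_set_scope.
Local Open Scope ring_scope.

(** * Commutators and powers in step two *)

Section IntegerPowers.
Variable G : groupType.
Implicit Types (x y : G) (a b : int) (T : set G).

Definition zpow x a : G :=
  match a with Posz n => (x ^+ n)%g | Negz n => (x ^- n.+1)%g end.

Lemma zpow0 x : zpow x 0 = 1%g. Proof. by []. Qed.

Lemma zpow1 x : zpow x 1 = x. Proof. exact: expg1. Qed.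

Lemma zpow1g a : zpow 1%g a = 1%g.
Proof. by case: a => n /=; rewrite expg1n ?invg1. Qed.

Lemma zpowSr x a : zpow x (a + 1) = (zpow x a * x)%g.
Proof.
case: a => [k|[|k]].
- by rewrite -PoszD addn1 /= expgSr.
- by rewrite /= expg1 mulVg.
- have -> : Negz k.+1 + 1 = Negz k :> int by rewrite !NegzE; lia.
  by rewrite /= [in RHS]expgS invgM mulgVK.
Qed.

Lemma zpowD x a b : zpow x (a + b) = (zpow x a * zpow x b)%g.
Proof.
elim/int_rec: b => [|k IH|k IH]; first by rewrite addr0 mulg1.
- by rewrite -addn1 PoszD addrA !zpowSr IH mulgA.
- apply: (@mulIg _ x); rewrite -mulgA -!zpowSr -!addrA -addn1 PoszD opprD.
  by rewrite addrNK IH.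
Qed.

Lemma zpowN x a : zpow x (- a) = ((zpow x a)^-1)%g.
Proof. by apply: (@mulIg _ (zpow x a)); rewrite -zpowD addNr mulVg. Qed.

Lemma commute_zpow x y a : commute x y -> commute x (zpow y a).
Proof.
by case: a => n xy /=; [|apply: commuteV]; apply: commuteX.
Qed.

Variables (T : set G) (sgT : is_subgroup T).

Lemma subgroup_expg x k : T x -> T (x ^+ k)%g.
Proof.
case: sgT => T1 TM _ Tx; elim: k => // k IH; rewrite expgS; exact: TM.
Qed.

Lemma subgroup_zpow x a : T x -> T (zpow x a).
Proof.
case: sgT => _ _ TV Tx; case: a => n /=; [|apply: TV]; exact: subgroup_expg.
Qed.

Lemma subgroup_commg x y : T x -> T y -> T [~ x, y]%g.
Proof.
case: sgT => _ TM TV Tx Ty.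
by apply: (TM); [exact: TV|apply: (TM); [exact: TV|exact: TM]].
Qed.

End IntegerPowers.

Section TwoStepNilpotent.
Variable G : groupType.
Hypothesis comm_central : forall x y z : G, commute [~ x, y]%g z.
Implicit Types (x y z : G) (T : set G).
Local Open Scope group_scope.

(** In any group [xy, z] is [x, z] conjugated by y, times [y, z]; centrality removes the
    conjugation. *)
Lemma commMg x y z : [~ x * y, z] = [~ x, z] * [~ y, z].
Proof.
have -> : [~ x * y, z] = y^-1 * [~ x, z] * z^-1 * y * z.
  by rewrite /commg /conjg invgM !mulgA mulgK.
by rewrite -(comm_central x z y^-1) -!mulgA.
Qed.


Lemma commgM x y z : [~ x, y * z] = [~ x, y] * [~ x, z].
Proof.
by rewrite -[LHS]invgK invgR commMg invgM !invgR comm_central.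
Qed.

Lemma commXg x y n : [~ x ^+ n, y] = [~ x, y] ^+ n.
Proof.
by elim: n => [|n IH]; rewrite ?comm1g // !expgS commMg IH.
Qed.

Lemma commVg x y : [~ x^-1, y] = [~ x, y]^-1.
Proof. by apply/esym/mulg1_eq; rewrite -commMg mulgV comm1g. Qed.

Lemma comm_zpowg x y a : [~ zpow x a, y] = zpow [~ x, y] a.
Proof. by case: a => n /=; rewrite ?commVg commXg. Qed.

Lemma commgX x y n : [~ x, y ^+ n] = [~ x, y] ^+ n.
Proof. by rewrite -invgR commXg -expVgn invgR. Qed.

Lemma commg_zpow x y a : [~ x, zpow y a] = zpow [~ x, y] a.
Proof. by case: a => n /=; rewrite -?commgX -1?invgR ?commVg ?invgR. Qed.

(** Each of the C(n, 2) moves of a y to the right past an x costs one central factor [y, x]. *)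
Lemma expMg x y n : (x * y) ^+ n = x ^+ n * y ^+ n * [~ y, x] ^+ 'C(n, 2).
Proof.
elim: n => [|n IH]; first by rewrite !mulg1.
have cz k z : commute ([~ y, x] ^+ k) z.
  by apply/commute_sym/commuteX/commute_sym.
rewrite expgSr IH binS bin1 addnC expgnDr mulgA.
rewrite -(mulgA _ x y) -(mulgA _ _ (x * y)) (cz _ (x * y)) !mulgA.
congr (_ * _); rewrite -(mulgA _ _ x) (commgC _ x) commXg !expgSr -!mulgA.
by rewrite (cz n y).
Qed.

Lemma commg_commg x y z : [~ [~ x, y], z] = 1.
Proof. exact/eqP/commgP. Qed.

End TwoStepNilpotent.

(** * Quasi-additive functions and their extensions *)

(* A function quasi-additive on all of G is a linear functional on the Malcev
   Lie algebra of G, composed with the logarithm: in step two the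
   Baker-Campbell-Hausdorff series is x + y + [x, y] / 2. *)
Definition quasi_additive (G : groupType) (T : set G) (f : G -> rat) :=
  forall x y, T x -> T y -> f (x * y)%g = f x + f y + f [~ x, y]%g / 2.

Section QuasiAdditive.
Variables (G : groupType) (T : set G) (f : G -> rat).
Hypotheses (sgT : is_subgroup T) (qf : quasi_additive T f).
Implicit Types x y : G.

Lemma quasi_additive1 : f 1%g = 0.
Proof.
case: sgT => T1 _ _; have := qf T1 T1; rewrite mulg1 commgg; lra.
Qed.

Lemma quasi_additiveD x y :
  T x -> T y -> commute x y -> f (x * y)%g = f x + f y.
Proof.
move=> Tx Ty /commgP/eqP xy.
by rewrite qf // xy quasi_additive1 mul0r addr0.
Qed.

Lemma quasi_additiveX x n : T x -> f (x ^+ n)%g = n%:R * f x.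
Proof.
move=> Tx; elim: n => [|n IH]; first by rewrite quasi_additive1 mul0r.
rewrite expgS quasi_additiveD //; last exact: commuteX.
- by rewrite IH -natr1 mulrDl mul1r addrC.
- exact: subgroup_expg.
Qed.

Lemma quasi_additive_zpow x a : T x -> f (zpow x a) = a%:~R * f x.
Proof.
move=> Tx; case: a => n /=; first exact: quasi_additiveX.
have Txn := subgroup_expg sgT n.+1 Tx.
have := quasi_additiveD Txn (subgroup_zpow sgT (Negz n) Tx)
  (commuteV (commute_refl _)).
rewrite /= mulgV quasi_additive1 quasi_additiveX // NegzE rmorphN /=.
rewrite mulNr => /esym/eqP; rewrite addr_eq0 => /eqP ->.
by rewrite opprK.
Qed.

Lemma quasi_additiveV x : T x -> f (x^-1)%g = - f x.
Proof.
by move=> Tx; have := quasi_additive_zpow (- 1) Tx; rewrite /= mulN1r expg1.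
Qed.

End QuasiAdditive.

Lemma quasi_additive_sub (G : groupType) (S T : set G) f :
  S `<=` T -> quasi_additive T f -> quasi_additive S f.
Proof. by move=> ST qf x y /ST Tx /ST Ty; exact: qf. Qed.

Definition isolated (G : groupType) (T : set G) :=
  forall x n, (0 < n)%N -> T (x ^+ n)%g -> T x.

Lemma isolated_zpow (G : groupType) (T : set G) x a : is_subgroup T ->
  isolated T ->
  a != 0 -> T (zpow x a) -> T x.
Proof.
move=> [_ _ TV] isoT; case: a => [[|n]|n] //= _; first exact: isoT.
by move/TV; rewrite invgK; exact: isoT.
Qed.

(** * Adjoining an element and its roots to an isolated subgroup *)

Section Adjoin.
Variable G : groupType.
Hypothesis comm_central : forall x y z : G, commute [~ x, y]%g z.
Variables (T : set G) (g : G).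
Hypothesis sgT : is_subgroup T.
Hypothesis isoT : isolated T.
Hypothesis Tg : ~ T g.
Implicit Types (x y : G) (a b : int).

Definition cyclic_adjoin : set G :=
  [set x | exists a t, T t /\ x = (zpow g a * t)%g].

(** Passing to all roots makes the enlarged subgroup isolated again, so that the construction can be
    iterated. *)
Definition adjoin : set G :=
  [set x | exists2 n, (0 < n)%N & cyclic_adjoin (x ^+ n)%g].

Lemma sub_cyclic_adjoin : T `<=` cyclic_adjoin.
Proof. by move=> x Tx; exists 0, x; rewrite mul1g. Qed.

Lemma cyclic_adjoin_gen : cyclic_adjoin g.
Proof. by exists 1, 1%g; rewrite zpow1 mulg1; case: sgT. Qed.

Lemma cyclic_adjoin_sub : cyclic_adjoin `<=` adjoin.
Proof. by move=> x Tx; exists 1%N. Qed.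

Lemma sub_adjoin : T `<=` adjoin.
Proof. by move=> x /sub_cyclic_adjoin/cyclic_adjoin_sub. Qed.

Lemma adjoin_gen : adjoin g.
Proof. exact/cyclic_adjoin_sub/cyclic_adjoin_gen. Qed.

Lemma adjoin_isolated x n : (0 < n)%N -> adjoin (x ^+ n)%g -> adjoin x.
Proof.
by move=> n0 [k k0]; rewrite -expgnA => ?; exists (n * k)%N => //;
   rewrite muln_gt0 n0.
Qed.

Lemma zpow_isolated a : T (zpow g a) -> a = 0.
Proof.
move=> Tga; apply/eqP; apply: contrapT => /negP a0.
exact/Tg/(isolated_zpow sgT isoT a0).
Qed.

(** As [T] is isolated and misses g, it contains no nonzero power of g. *)
Lemma zpow_mulI a b s t : T s -> T t ->
  (zpow g a * s = zpow g b * t)%g -> a = b /\ s = t.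
Proof.
move=> Ts Tt e.
have e' : a - b = 0.
  apply: zpow_isolated; rewrite addrC zpowD zpowN.
  have -> : ((zpow g b)^-1 * zpow g a = t * s^-1)%g.
    by apply: (@mulgI _ (zpow g b)); apply: (@mulIg _ s);
      rewrite mulVKg e mulgA mulgVK.
  by case: sgT => _ TM TV; apply: TM => //; apply: TV.
move/eqP: e'; rewrite subr_eq0 => /eqP ab; split=> //.
by move: e; rewrite ab => /mulgI.
Qed.

Hypothesis commT : forall x y, adjoin x -> adjoin y -> T [~ x, y]%g.

Let T1 : T 1%g. Proof. by case: sgT. Qed.
Let TM x y : T x -> T y -> T (x * y)%g. Proof. by case: sgT => _ + _; apply. Qed.
Let TV x : T x -> T (x^-1)%g. Proof. by case: sgT => _ _; apply. Qed.
Let Tcg t : T t -> T [~ g, t]%g.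
Proof. by move=> Tt; apply: commT; [exact: adjoin_gen|exact: sub_adjoin]. Qed.

Lemma mul_cyclic_adjoin a b s t : (zpow g a * s * (zpow g b * t) =
  zpow g (a + b) * (s * zpow [~ s, g] b * t))%g.
Proof.
rewrite zpowD -!mulgA; congr (_ * _)%g.
by rewrite (mulgA s (zpow g b)) (commgC s (zpow g b)) commg_zpow // !mulgA.
Qed.


(** The formula is forced: it is quasi-additivity at g^a and t, with value r at g and [g^a, t] =
    [g, t]^a. *)
Lemma cyclic_extension (f : G -> rat) (r : rat) : quasi_additive T f ->
  exists2 h, quasi_additive cyclic_adjoin h &
    forall a t, T t ->
      h (zpow g a * t)%g = a%:~R * r + f t + a%:~R * f [~ g, t]%g / 2.
Proof.
move=> qf.
(* Uniqueness of the decomposition g^a t makes the value well defined; outside [cyclic_adjoin] it is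
   set to 0. *)
have /choice[h hE] : forall x, exists v : rat,
    forall a t, T t -> x = (zpow g a * t)%g ->
      v = a%:~R * r + f t + a%:~R * f [~ g, t]%g / 2.
  move=> x.
  have [[a [t [Tt ->]]]|nx] := pselect (cyclic_adjoin x).
    by eexists => b s Ts /(zpow_mulI Tt Ts)[<- <-].
  by exists 0 => a t Tt xE; case: nx; exists a, t.
exists h => [x y [a [s [Ts xE]]] [b [t [Tt yE]]]|a t Tt]; last exact: hE.
have Tst := subgroup_commg sgT Ts Tt.
have Tsg : T [~ s, g]%g by rewrite -invgR; exact/TV/Tcg.
have Tz k := subgroup_zpow sgT k Tsg.
have Tw k := subgroup_zpow sgT k (Tcg Tt).
have cz k z : commute (zpow [~ s, g]%g k) z.
  by apply/commute_sym/commute_zpow/commute_sym.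
have cw k z : commute (zpow [~ g, t]%g k) z.
  by apply/commute_sym/commute_zpow/commute_sym.
(* The commutator has exponent 0 in g, so [h] agrees with [f] on its expression in [T]. *)
have xyE : [~ x, y]%g =
    (zpow g 0 * (zpow [~ g, t] a * (zpow [~ s, g] b * [~ s, t])))%g.
  rewrite xE yE commMg // !commgM // !comm_zpowg // !commg_zpow // commgg.
  by rewrite !zpow1g !mul1g.
have -> : h (x * y)%g = (a + b)%:~R * r
    + (f s + b%:~R * f [~ s, g]%g + f t + f [~ s, t]%g / 2)
    + (a + b)%:~R * (f [~ g, s]%g + f [~ g, t]%g) / 2.
  rewrite xE yE mul_cyclic_adjoin.
  rewrite (hE _ _ _ (TM (TM Ts (Tz b)) Tt) erefl).
  rewrite qf //; last exact: TM.
  rewrite (quasi_additiveD sgT qf Ts (Tz b)); last exact/commute_sym/cz.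
  rewrite (commMg _ s) // !commgM //.
  rewrite (_ : [~ zpow [~ s, g] b, t]%g = 1%g); last exact/eqP/commgP/cz.
  rewrite (_ : [~ g, zpow [~ s, g] b]%g = 1%g);
    last exact/eqP/commgP/commute_sym/cz.
  rewrite !mulg1 (quasi_additiveD sgT qf (Tcg Ts) (Tcg Tt)) //.
  by rewrite (quasi_additive_zpow sgT qf).
have -> : h [~ x, y]%g =
   a%:~R * f [~ g, t]%g + (b%:~R * f [~ s, g]%g + f [~ s, t]%g).
  rewrite (hE _ _ _ (TM (Tw a) (TM (Tz b) Tst)) xyE) !mul0r add0r addr0.
  rewrite (quasi_additiveD sgT qf (Tw a)) ?(quasi_additiveD sgT qf (Tz b)) //.
  - by rewrite !(quasi_additive_zpow sgT qf) //; exact: Tcg.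
  - exact: TM.
rewrite (hE _ _ _ Ts xE) (hE _ _ _ Tt yE).
rewrite -invgR (quasi_additiveV sgT qf) //; last exact: Tcg.
rewrite !rmorphD /=. lra.
Qed.


Lemma cyclic_adjoin_subgroup : is_subgroup cyclic_adjoin.
Proof.
split; first exact: sub_cyclic_adjoin.
- move=> _ _ [a [s [Ts ->]]] [b [t [Tt ->]]]; rewrite mul_cyclic_adjoin.
  exists (a + b), (s * zpow [~ s, g] b * t)%g; split=> //.
  apply: TM => //; apply: TM => //; apply: subgroup_zpow => //.
  by rewrite -invgR; exact/TV/Tcg.
- move=> _ [a [t [Tt ->]]]; exists (- a), (t^-1 * zpow [~ t^-1, g] (- a))%g.
  split; first apply: TM; first exact: TV.
    by apply: subgroup_zpow => //; rewrite -invgR; exact/TV/Tcg/TV.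
  have := mul_cyclic_adjoin 0 (- a) (t^-1)%g 1%g.
  by rewrite mul1g add0r !mulg1 zpowN => <-; rewrite invgM.
Qed.

Lemma adjoin_subgroup : is_subgroup adjoin.
Proof.
have sgC := cyclic_adjoin_subgroup; have [_ CM CV] := sgC.
have cX k x : cyclic_adjoin x -> cyclic_adjoin (x ^+ k)%g.
  exact: subgroup_expg.
split; first exact: sub_adjoin.
- move=> x y Ax Ay; have Tyx := commT Ay Ax.
  have [[n n0 Cx] [k k0 Cy]] := (Ax, Ay).
  exists (n * k)%N; first by rewrite muln_gt0 n0.
  rewrite expMg //; apply: (CM); first apply: (CM).
  + by rewrite expgnA; exact: cX.
  + by rewrite mulnC expgnA; exact: cX.
  + by apply: sub_cyclic_adjoin; apply: subgroup_expg.
- by move=> x [n n0 Cx]; exists n => //; rewrite expVgn; exact: CV.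
Qed.

(** Quasi-additivity forces the value h(x^n) / n at an n-th root x, and any two exponents n, k give
    the same value by comparison at x^(nk). *)
Lemma root_extension (h : G -> rat) : quasi_additive cyclic_adjoin h ->
  exists2 f, quasi_additive adjoin f & forall x, cyclic_adjoin x -> f x = h x.
Proof.
move=> qh; have sgC := cyclic_adjoin_subgroup.
have cX k x : cyclic_adjoin x -> cyclic_adjoin (x ^+ k)%g.
  exact: subgroup_expg.
have /choice[f fE] : forall x, exists v : rat, forall n, (0 < n)%N ->
    cyclic_adjoin (x ^+ n)%g -> h (x ^+ n)%g = n%:R * v.
  move=> x; have [[n n0 Cn]|nx] := pselect (adjoin x); last first.
    by exists 0 => n n0 Cn; case: nx; exists n.
  exists (h (x ^+ n)%g / n%:R) => k k0 Ck.
  have nn0 : n%:R != 0 :> rat by rewrite pnatr_eq0 -lt0n.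
  apply: (mulfI nn0); rewrite -(quasi_additiveX sgC qh) // -expgnA mulnC expgnA.
  by rewrite (quasi_additiveX sgC qh k Cn) [RHS]mulrCA (mulrC n%:R) divfK.
have fC x : cyclic_adjoin x -> f x = h x.
  by move=> Cx; have := fE x 1%N isT; rewrite mul1r expg1 => ->.
exists f => // x y Ax Ay; have Tyx := commT Ay Ax.
have Txy : T [~ x, y]%g by rewrite -invgR; exact: TV.
(* Quasi-additivity at x, y is checked after multiplication by N, on N-th powers. The commutator
   terms are N^2 / 2 from [x^N, y^N] and - C(N, 2) from collecting (xy)^N, and they add up to N /
   2. *)
have [[n n0 Cx] [k k0 Cy]] := (Ax, Ay); set N := (n * k)%N.
have N0 : (0 < N)%N by rewrite muln_gt0 n0.
have CxN : cyclic_adjoin (x ^+ N)%g by rewrite expgnA; exact: cX.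
have CyN : cyclic_adjoin (y ^+ N)%g by rewrite /N mulnC expgnA; exact: cX.
have NN0 : N%:R != 0 :> rat by rewrite pnatr_eq0 -lt0n.
have Cc m : cyclic_adjoin ([~ y, x] ^+ m)%g.
  by apply: sub_cyclic_adjoin; apply: subgroup_expg.
have [_ CM _] := sgC.
have hxy : h ((x * y) ^+ N)%g = h (x ^+ N)%g + h (y ^+ N)%g
    + h [~ x ^+ N, y ^+ N]%g / 2 + h ([~ y, x] ^+ 'C(N, 2))%g.
  rewrite expMg // (quasi_additiveD sgC qh (CM _ _ CxN CyN) (Cc _)).
    by rewrite (qh _ _ CxN CyN).
  exact/commuteX/commute_sym.
have CxyN : cyclic_adjoin ((x * y) ^+ N)%g.
  by rewrite expMg //; apply: (CM _ _ (CM _ _ CxN CyN)).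
have Cyx := sub_cyclic_adjoin Tyx; have Cxy := sub_cyclic_adjoin Txy.
have hc : h [~ x ^+ N, y ^+ N]%g = N%:R * (N%:R * f [~ x, y]%g).
  rewrite commXg // commgX // (quasi_additiveX sgC qh N (cX N _ Cxy)).
  by rewrite (quasi_additiveX sgC qh N Cxy) fC.
have hC : h ([~ y, x] ^+ 'C(N, 2))%g = - ('C(N, 2)%:R * f [~ x, y]%g).
  rewrite (quasi_additiveX sgC qh _ Cyx) -(invgR x y).
  by rewrite (quasi_additiveV sgC qh Cxy) fC // mulrN.
apply: (mulfI NN0); rewrite -(fE _ _ N0 CxyN) hxy hc hC.
rewrite (fE _ _ N0 CxN) (fE _ _ N0 CyN).
have -> : ('C(N, 2))%:R = N%:R * (N%:R - 1) / 2 :> rat.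
  elim: (N) => [|m IH]; first by rewrite !mul0r.
  by rewrite binS bin1 natrD IH -natr1; field.
by field.
Qed.

Lemma quasi_additive_extension (f : G -> rat) r : quasi_additive T f ->
  exists h, [/\ quasi_additive adjoin h, h g = r & forall x, T x -> h x = f x].
Proof.
move=> qf; have [h qh hE] := cyclic_extension r qf.
have [k qk kE] := root_extension qh.
have f1 : f 1%g = 0 by exact: quasi_additive1 qf.
exists k; split=> // [|x Tx]; rewrite kE.
- have := hE 1 1%g T1.
  by rewrite zpow1 mulg1 f1 addr0 commg1 f1 !mul1r mul0r addr0.
- exact: cyclic_adjoin_gen.
- by have := hE 0 x Tx; rewrite zpow0 mul1g !mul0r add0r addr0.
- exact: sub_cyclic_adjoin.
Qed.

(** Some positive power of x is g^a t, where [f] vanishes, and [f] is homogeneous on powers. *)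
Lemma quasi_additive_ext0 (f : G -> rat) : quasi_additive adjoin f ->
  (forall x, T x -> f x = 0) -> f g = 0 -> forall x, adjoin x -> f x = 0.
Proof.
move=> qf fT fg x Ax; have sgA := adjoin_subgroup.
have Ag := adjoin_gen.
have [n n0 [a [t [Tt xE]]]] := Ax.
have := quasi_additiveX sgA qf n Ax.
rewrite xE qf; last 2 first.
- exact: subgroup_zpow.
- exact: sub_adjoin.
rewrite (quasi_additive_zpow sgA qf) // fg fT // comm_zpowg //.
rewrite (quasi_additive_zpow sgA qf); last exact/sub_adjoin/Tcg.
rewrite (fT _ (Tcg Tt)) !mulr0 mul0r !addr0 => /esym/eqP.
by rewrite mulf_eq0 pnatr_eq0 -leqn0 leqNgt n0 => /eqP.
Qed.

End Adjoin.

(** * Rank of isolated subgroups *)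

Section Generated.
Variable G : groupType.
Implicit Types S K H : set G.

Lemma generated_subgroup S : is_subgroup (generated S).
Proof.
split=> [K [[]] //|x y Sx Sy K KP|x Sx K KP].
- by case: (KP) => -[_ KM _] _; apply: KM; [exact: Sx|exact: Sy].
- by case: (KP) => -[_ _ KV] _; apply: KV; exact: Sx.
Qed.

Lemma sub_generated S : S `<=` generated S.
Proof. by move=> x Sx K [_]; apply. Qed.

Lemma generated_sub S K : is_subgroup K -> S `<=` K -> generated S `<=` K.
Proof. by move=> sK SK x; apply. Qed.

Lemma cyclic_factorP K H : is_subgroup K -> normal_in K H -> cyclic_factor K H ->
  exists g, (forall b k, K k -> K (k ^ zpow g b)%g) /\
    forall x, H x -> exists a k, K k /\ x = (zpow g a * k)%g.
Proof.
move=> sK [KH nK] [g Hg HE]; exists g.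
have sH : is_subgroup H by rewrite HE; exact: generated_subgroup.
have nKg b k : K k -> K (k ^ zpow g b)%g.
  by move=> Kk; apply: nK => //; apply: subgroup_zpow.
have [K1 KM KV] := sK.
(* By minimality of [generated], it suffices that the products g^a k form a subgroup containing g
   and [K]. *)
split=> // x; rewrite HE => /(_ [set x | exists a k, K k /\ x = (zpow g a * k)%g]).
apply; split.
  split.
  - by exists 0, 1%g; rewrite mulg1.
  - move=> _ _ [a [k [Kk ->]]] [b [l [Kl ->]]].
    exists (a + b), (k ^ zpow g b * l)%g; split.
      by apply: KM => //; exact: nKg.
    by rewrite zpowD conjgE !mulgA mulgK.
  - move=> _ [a [k [Kk ->]]]; exists (- a), ((k^-1) ^ zpow g (- a))%g.
    by split; [exact/nKg/KV|rewrite invgM -conjgC zpowN].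
move=> y [->|Ky]; last by exists 0, y; rewrite mul1g.
by exists 1, 1%g; rewrite zpow1 mulg1.
Qed.

End Generated.

Section Rank.
Variables (G : groupType) (m : nat) (H : nat -> set G).
Hypotheses (H0 : H 0%N = [set 1%g]) (Hm : H m = setT).
Hypothesis HP : forall i, (i < m)%N ->
  [/\ is_subgroup (H i), normal_in (H i) (H i.+1) & cyclic_factor (H i) (H i.+1)].
Implicit Types T : set G.

Definition jump T i : Prop :=
  exists s, [/\ T s, H i.+1 s & forall k, (0 < k)%N -> ~ H i (s ^+ k)%g].

(** For a subgroup [T] this is its Hirsch length, read off from the series of intersections of [T]
    with the [H i]. *)
Definition rank T : nat := \sum_(i < m) `[< jump T i >].

(** The cosets of the powers of s modulo [H i] are pairwise distinct. *)
Lemma jump_infinite T i : is_subgroup (H i) -> is_subgroup (H i.+1) ->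
  jump T i -> infinite_factor (H i) (H i.+1).
Proof.
move=> [h1 hM hV] sH [s [_ Hs nH]] fin; apply: infinite_nat.
pose f k := [set (s ^+ k * h)%g | h in H i].
have -> : [set: nat] = f @^-1` [set [set (x * k)%g | k in H i] | x in H i.+1].
  apply/esym/seteqP; split=> // k _ /=; exists (s ^+ k)%g => //.
  exact: subgroup_expg.
apply: finite_preimage fin => j k _ _ ejk.
wlog jk : j k ejk / (j <= k)%N.
  by move=> W; case/orP: (leq_total j k) => ?; [|apply/esym]; apply: W.
move: jk; rewrite leq_eqVlt => /predU1P[//|jk].
have : f k (s ^+ k)%g by exists 1%g; rewrite ?mulg1.
rewrite -ejk => -[h Hh e]; case: (nH (k - j)%N); first by rewrite subn_gt0.
suff -> : (s ^+ (k - j))%g = h by [].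
by apply: (@mulgI _ (s ^+ j)%g); rewrite e -expgnDr subnKC // ltnW.
Qed.

(** Induction along the series shows that each intersection of [T'] with [H i] lies in [T]. *)
Lemma no_jump_sub T T' : is_subgroup T -> is_subgroup T' -> T `<=` T' ->
  isolated T ->
  (forall i, (i < m)%N -> jump T' i -> jump T i) -> T' `<=` T.
Proof.
move=> sT sT' TT' isoT jT; have [T1 TM TV] := sT; have [_ TM' TV'] := sT'.
suff claim i x : (i <= m)%N -> T' x -> H i x -> T x.
  by move=> x T'x; apply: (claim m) => //; rewrite Hm.
elim: i x => [|i IH] x im T'x; first by rewrite H0 => ->.
(* If a positive power of x lies in [H i], induction and isolation of [T] conclude. Otherwise x is a
   jump of [T'], and the hypothesis supplies t in [T] of infinite order modulo [H i]. *)
move=> Hx; have [Kjump|/existsNP[k /not_implyP[k0 /contrapT Hk]]] :=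
    pselect (forall k, (0 < k)%N -> ~ H i (x ^+ k)%g); last first.
  by apply: isoT k0 _; apply: IH Hk; [exact: ltnW|exact: subgroup_expg].
have [sK nK cK] := HP im; have [K1 KM KV] := sK.
have [t [Tt Ht Kt]] := jT _ im (ex_intro _ x (And3 T'x Hx Kjump)).
have [g [nKg gP]] := cyclic_factorP sK nK cK.
(* Writing x and t as g^a and g^b modulo H i, the element x^b t^(-a) lies in
   H i, hence in T by induction, and so does x^b. *)
pose R y a := H i ((zpow g a)^-1 * y)%g.
have RM y z a b : R y a -> R z b -> R (y * z)%g (a + b).
  move=> Ry Rz; rewrite /R zpowD invgM.
  have -> : ((zpow g b)^-1 / zpow g a * (y * z) =
     (((zpow g a)^-1 * y) ^ zpow g b) * ((zpow g b)^-1 * z))%g.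
    by rewrite conjgE !mulgA mulgK.
  by apply: KM => //; exact: nKg.
have RV y a : R y a -> R (y^-1)%g (- a).
  move=> /KV/(nKg (- a)); rewrite /R !zpowN conjgE !invgM !invgK.
  by rewrite !mulgA mulgK.
have RX y a n : R y a -> R (y ^+ n)%g (a * n%:Z).
  move=> Ry; elim: n => [|n IHn]; first by rewrite mulr0 /R invg1 mul1g.
  by rewrite expgSr -addn1 PoszD mulrDr mulr1; apply: RM.
have RZ y a b : R y a -> R (zpow y b) (a * b).
  move=> Ry; case: b => n /=; first exact: RX.
  by rewrite NegzE mulrN; exact/RV/RX.
have [a Ra] : exists a, R x a.
  by have [a [k [Kk ->]]] := gP _ Hx; exists a; rewrite /R mulKg.
have [b Rb] : exists b, R t b.
  by have [b [k [Kk ->]]] := gP _ Ht; exists b; rewrite /R mulKg.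
(* For b = 0 the element t itself would lie in [H i]. *)
have b0 : b != 0.
  apply/eqP => b0; apply: (Kt 1%N) => //.
  by move: Rb; rewrite b0 /R invg1 mul1g expg1.
apply: (isolated_zpow sT isoT b0).
have : R (zpow x b * zpow t (- a))%g 0.
  have := RM _ _ _ _ (RZ _ _ b Ra) (RZ _ _ (- a) Rb).
  by rewrite mulrN mulrC subrr.
have tT := subgroup_zpow sT a Tt.
rewrite /R invg1 mul1g => /(IH _ (ltnW im)) h.
have /TM/(_ tT) : T (zpow x b * zpow t (- a))%g.
  by apply: h; apply: TM'; apply: subgroup_zpow => //; exact: TT'.
by rewrite zpowN mulgVK.
Qed.

(** Jumps of [T] are jumps of [T']; without a new one, [no_jump_sub] would put g in [T]. *)
Lemma rank_lt T T' g : is_subgroup T -> is_subgroup T' -> T `<=` T' ->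
  isolated T -> T' g -> ~ T g ->
  (rank T < rank T')%N.
Proof.
move=> sT sT' TT' isoT T'g Tg.
have jTT' i : jump T i -> jump T' i.
  by move=> [s [Ts Hs ns]]; exists s; split=> //; exact: TT'.
have [i [im [jT' jT]]] : exists i, (i < m)%N /\ jump T' i /\ ~ jump T i.
  apply: contrapT => nj; apply: Tg; apply: (no_jump_sub sT sT' TT' isoT) => //.
  by move=> i im jT'; apply: contrapT => jT; apply: nj; exists i.
rewrite /rank (bigD1 (Ordinal im)) // [X in (_ < X)%N](bigD1 (Ordinal im)) //=.
rewrite (asboolT jT') (asboolF jT) add0n add1n ltnS; apply: leq_sum => j _.
have [/jTT'/asboolT -> //|/asboolF -> //] := pselect (jump T j).
by case: asboolP.
Qed.

Lemma rank_le T :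
  (rank T <= \sum_(i < m) `[< infinite_factor (H i) (H i.+1) >])%N.
Proof.
apply: leq_sum => i _; have [jT|/asboolF -> //] := pselect (jump T i).
rewrite (asboolT jT) asboolT //; apply: jump_infinite jT.
  by have [] := HP (ltn_ord i).
have : (i.+1 <= m)%N by [].
rewrite leq_eqVlt => /predU1P[->|im]; first by rewrite Hm.
by have [] := HP im.
Qed.

End Rank.

(** * Logarithmic coordinates *)

Lemma quasi_additive_comb (G : groupType) (T : set G) p (f : G -> rat)
    (c : 'I_p -> rat) (h : 'I_p -> G -> rat) :
  quasi_additive T f -> (forall i, quasi_additive T (h i)) ->
  quasi_additive T (fun x => f x - \sum_i c i * h i x).
Proof.
move=> qf qh x y Tx Ty; rewrite qf //.
have -> : \sum_i c i * h i (x * y)%g = \sum_i c i * h i x + \sum_i c i * h i y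
    + (\sum_i c i * h i [~ x, y]%g) / 2.
  rewrite mulr_suml -!big_split /=; apply: eq_bigr => i _; rewrite qh //; ring.
ring.
Qed.

Section Chain.
Variable G : groupType.
Hypothesis comm_central : forall x y z : G, commute [~ x, y]%g z.
Hypothesis tfG : torsion_free G.
Implicit Types (T : set G) (x y g : G).

Definition centre : set G := [set z | forall y, commute z y].

(* The subgroups in the chain leading from 1 through the centre to G. *)
Definition chain_member T :=
  [/\ is_subgroup T, isolated T & T `<=` centre \/ centre `<=` T].

(** If x^n is central then [x, y]^n = [x^n, y] = 1, and torsion-freeness gives [x, y] = 1. *)
Lemma centre_isolated : isolated centre.
Proof.
move=> x n n0 Zx y; apply/commgP/eqP; apply: (tfG n0).
by rewrite -commXg //; apply/eqP/commgP/Zx.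
Qed.

Lemma centre_subgroup : is_subgroup centre.
Proof.
split=> [y|x y Zx Zy z|x Zx y]; first exact/commute_sym/commute1.
- by apply/commute_sym/commuteM; apply/commute_sym.
- by apply/commute_sym/commuteV/commute_sym.
Qed.

Lemma chain_member1 : chain_member [set 1%g].
Proof.
split; last by left=> _ -> y; exact/commute_sym/commute1.
- by split=> [//|_ _ -> ->|_ ->]; rewrite ?mulg1 ?invg1.
- by move=> x n n0 /= /(tfG n0).
Qed.

(** As long as [T] misses part of the centre, g is taken central, and [adjoin T g] stays in the
    isolated centre, with trivial commutators. Once [T] contains the centre, any g outside [T] will
    do, since all commutators are central. *)
Lemma chain_step T : chain_member T -> T <> setT ->
  exists g, [/\ ~ T g, chain_member (adjoin T g)
    & forall x y, adjoin T g x -> adjoin T g y -> T [~ x, y]%g].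
Proof.
move=> [sT iT TZ] nT.
have [g [Tg]] : exists g, ~ T g /\ (adjoin T g `<=` centre \/ centre `<=` T).
  have [ZT|/existsNP[g /not_implyP[Zg Tg]]] := pselect (centre `<=` T).
    have [g Tg] : exists g, ~ T g.
      apply: contrapT => /forallNP H; apply: nT; apply/seteqP; split=> // x _.
      by apply: contrapT; exact: H.
    by exists g; split=> //; right.
  exists g; split=> //; left=> x [n n0 [a [t [Tt xE]]]].
  have {}TZ : T `<=` centre by case: TZ => // ZT; case: Tg; exact: ZT.
  apply: (centre_isolated n0); rewrite xE; have [_ ZM _] := centre_subgroup.
  by apply: ZM; [exact: (subgroup_zpow centre_subgroup)|exact: TZ].
move=> AZ; have cT x y : adjoin T g x -> adjoin T g y -> T [~ x, y]%g.
  case: AZ => [AZ|ZT] Ax Ay; last exact/ZT/comm_central.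
  rewrite (_ : [~ x, y]%g = 1%g); first by case: sT.
  by apply/eqP/commgP; exact: AZ.
exists g; split=> //; split.
- exact: adjoin_subgroup.
- by move=> x n; exact: adjoin_isolated.
- by case: AZ => [|ZT]; [left|right=> x /ZT; exact: sub_adjoin].
Qed.

(** The first p functions are coordinates of the logarithm on [T], and [e] recovers the coefficients
    of any functional. Indexing by [nat] lets p grow along the chain. *)
Definition log_coordinates T p (e : nat -> G) (c : nat -> G -> rat) :=
  [/\ forall i, quasi_additive T (c i),
      forall f, quasi_additive T f -> forall x, T x ->
        f x = \sum_(i < p) f (e i) * c i x
    & forall x, T x -> (forall i, (i < p)%N -> c i x = 0) -> x = 1%g].

Lemma log_coordinates_step T g p e c : chain_member T -> ~ T g ->
  (forall x y, adjoin T g x -> adjoin T g y -> T [~ x, y]%g) ->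
  log_coordinates T p e c ->
  exists e' c', log_coordinates (adjoin T g) p.+1 e' c'.
Proof.
move=> [sT iT _] Tg cT [qc cE c1].
have ext r f := @quasi_additive_extension G comm_central T g sT iT Tg cT f r.
(* Old coordinates are extended by 0 at g; the new one, of index p, extends the zero function by 1
   at g. *)
have /choice[c' c'P] : forall i, exists h, [/\ quasi_additive (adjoin T g) h,
    h g = (i == p)%:R & forall x, T x -> h x = if (i < p)%N then c i x else 0].
  move=> i; apply: (ext); case: (i < p)%N; first exact: qc.
  by move=> x y _ _; rewrite mul0r !addr0.
have sA := adjoin_subgroup comm_central sT cT.
exists (fun i => if (i < p)%N then e i else g), c'; split.
- by move=> i; have [] := c'P i.
(* The difference of the two sides is quasi-additive and vanishes on [T] and at g, hence everywhere
   on [adjoin T g]. *)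
- move=> f qf x Ax; apply/eqP; rewrite -subr_eq0; apply/eqP; move: x Ax.
  have fT : quasi_additive T f by apply: quasi_additive_sub qf; exact: sub_adjoin.
  apply: (@quasi_additive_ext0 _ comm_central _ _ sT cT).
  + by apply: quasi_additive_comb => // i; have [] := c'P i.
  + move=> x Tx; rewrite big_ord_recr /= ltnn.
    have [_ _ /(_ x Tx) ->] := c'P p; rewrite ltnn mulr0 addr0.
    apply/eqP; rewrite subr_eq0; apply/eqP; rewrite cE //.
    apply: eq_bigr => i _; rewrite ltn_ord.
    by have [_ _ /(_ x Tx) ->] := c'P i; rewrite ltn_ord.
  + rewrite big_ord_recr /= ltnn; have [_ -> _] := c'P p.
    rewrite eqxx mulr1 big1 ?add0r ?subrr // => i _; have [_ -> _] := c'P i.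
    by rewrite (ltn_eqF (ltn_ord i)) mulr0.
- move=> x Ax x0; have [n n0 [a [t [Tt xE]]]] := Ax.
  have [qp pg pT] := c'P p.
  have Ag : adjoin T g g by exact: adjoin_gen.
  have Tgt : T [~ g, t]%g by apply: cT => //; exact: sub_adjoin.
  (* The new coordinate of x^n = g^a t is a, and it vanishes with that of x. *)
  have a0 : a = 0.
    have := quasi_additiveX sA qp n Ax.
    rewrite (x0 p) // mulr0 xE qp; last 2 first.
    - exact: subgroup_zpow.
    - exact: sub_adjoin.
    rewrite (quasi_additive_zpow sA qp) // pg eqxx mulr1 pT // ltnn.
    rewrite comm_zpowg // pT; last exact: subgroup_zpow.
    by rewrite ltnn mul0r !addr0 => /eqP; rewrite intr_eq0 => /eqP.
  have Tx : T x by apply: iT n0 _; rewrite xE a0 mul1g.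
  apply: c1 => // i ip; have [_ _ /(_ x Tx)] := c'P i; rewrite ip => <-.
  by apply: x0; exact: ltnW.
Qed.

Lemma log_coordinates_exist n : has_hirsch_length G n ->
  exists (e : 'I_n -> G) (c : 'I_n -> G -> rat),
  [/\ forall i, quasi_additive setT (c i),
      forall f, quasi_additive setT f -> forall x, f x = \sum_i f (e i) * c i x
    & forall x, (forall i, c i x = 0) -> x = 1%g].
Proof.
move=> [m [H [H0 Hm HP ->]]].
set n' := (\sum_(i < m) _)%N.
have [p [e [c [pn [qc cE c1]]]]] : exists p e c,
    (p <= n')%N /\ log_coordinates setT p e c.
  (* Induction on a bound [k] for the gap between the Hirsch length and [rank T]; the invariant that
     p is at most [rank T] bounds the number of coordinates. *)
  suff W k T p e c : chain_member T -> log_coordinates T p e c ->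
      (p <= rank m H T)%N -> (n' - rank m H T < k)%N ->
      exists p e c, (p <= n')%N /\ log_coordinates setT p e c.
    apply: (W n'.+1 _ 0%N (fun=> 1%g) (fun _ _ => 0) chain_member1) => //.
      split=> // f qf x ->; rewrite big_ord0; apply: (quasi_additive1 _ qf).
      by have [] := chain_member1.
    by rewrite ltnS leq_subr.
  elim: k T p e c => [//|k IH] T p e c gT cT pT nk.
  have rT := rank_le Hm HP T.
  have [TT|nT] := pselect (T = setT);
    first by exists p, e, c; split; [exact: leq_trans rT|rewrite -TT].
  have [g [Tg gA cA]] := chain_step gT nT.
  have [[sT iT _] [sA _ _]] := (gT, gA).
  have rlt : (rank m H T < rank m H (adjoin T g))%N
    by apply: (@rank_lt _ _ _ H0 Hm HP _ _ g) => //;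
      [exact: sub_adjoin|exact: adjoin_gen].
  have rA := rank_le Hm HP (adjoin T g).
  have [e' [c' ecA]] := log_coordinates_step gT Tg cA cT.
  apply: (IH _ _ _ _ gA ecA); first exact: leq_ltn_trans rlt.
  by move: nk rlt rA; rewrite -/n'; lia.
(* Zero functions pad the p coordinates to the full number n. *)
exists (fun i => e i), (fun i => if (i < p)%N then c i else fun=> 0); split.
- by move=> i; case: ifP => // _ x y _ _; rewrite mul0r !addr0.
- move=> f qf x; rewrite (cE f qf x I).
  rewrite (big_ord_widen _ (fun i => f (e i) * c i x) pn).
  by rewrite big_mkcond; apply: eq_bigr => i _; case: ifP; rewrite ?mulr0.
- move=> x x0; apply: c1 => // i ip; have := x0 (Ordinal (leq_trans ip pn)).
  by rewrite /= ip.
Qed.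

End Chain.

(* The coordinates of [x, y] are additive in x and in y, so a denominator for the
   commutators of the generators serves for all commutators. *)
Lemma common_denominator (G : groupType) n (c : 'I_n -> G -> rat) :
  (forall x y z : G, commute [~ x, y]%g z) -> finitely_generated G ->
  (forall i, quasi_additive setT (c i)) ->
  exists2 D : nat, (0 < D)%N & forall i x, exists a : int, D%:R * c i x = a%:~R.
Proof.
move=> cc [S [finS genS]] qc.
have sgG : is_subgroup [set: G] by [].
have denom1 (q : rat) : exists2 D : nat, (0 < D)%N &
    exists a : int, D%:R * q = a%:~R.
  exists `|denq q|%N; first by rewrite absz_gt0 denq_neq0.
  by exists (numq q); rewrite mulrC natr_absz normr_denq numqE.
have denomS (s : seq rat) : exists2 D : nat, (0 < D)%N &
    forall q, q \in s -> exists a : int, D%:R * q = a%:~R.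
  elim: s => [|q s [D D0 sP]]; first by exists 1%N.
  have [E E0 [b qb]] := denom1 q.
  exists (D * E)%N; first by rewrite muln_gt0 D0.
  move=> r; rewrite inE => /predU1P[->|/sP[a ra]].
    by exists (D%:Z * b); rewrite natrM -mulrA qb intrM.
  by exists (E%:Z * a); rewrite mulnC natrM -mulrA ra intrM.
have /finite_seqP[s sE] := finS.
have Ss x : S x -> x \in s by rewrite {1}sE.
(* [D] clears the commutators of generators, and [E] below clears the generators themselves. *)
have [D D0 DP] := denomS [seq c i [~ xy.1, xy.2]%g | i <- enum 'I_n,
  xy <- [seq (x, y) | x <- s, y <- s]].
have [E E0 EP] := denomS [seq c i x | i <- enum 'I_n, x <- s].
pose Z (q : rat) := exists a : int, q = a%:~R.
have ZD q r : Z q -> Z r -> Z (q + r).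
  by move=> [a ->] [b ->]; exists (a + b); rewrite rmorphD.
have ZN q : Z q -> Z (- q) by move=> [a ->]; exists (- a); rewrite rmorphN.
have ZM k q : Z q -> Z (k%:R * q).
  by move=> [a ->]; exists (k%:Z * a); rewrite intrM.
have Z0 : Z 0 by exists 0.
have c1 i : c i 1%g = 0 by exact: quasi_additive1 (qc i).
have cD i x y : commute x y -> c i (x * y)%g = c i x + c i y.
  exact: (quasi_additiveD sgG (qc i)).
have cV i x : c i (x^-1)%g = - c i x by exact: (quasi_additiveV sgG (qc i)).
have genP (P : set G) : is_subgroup P -> S `<=` P -> forall x, P x.
  by move=> sP SP x; have := generated_sub sP SP; rewrite genS; apply.
have sg_comm i y : is_subgroup [set x | Z (D%:R * c i [~ x, y]%g)].
  split=> /= [|x x' Zx Zx'|x Zx]; first by rewrite comm1g c1 mulr0.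
  - by rewrite commMg // cD // mulrDr; exact: ZD.
  - by rewrite commVg // cV mulrN; exact: ZN.
have Zc1 i x y : S y -> Z (D%:R * c i [~ x, y]%g).
  move=> Sy; move: x; apply: (genP _ (sg_comm i y)) => x Sx; apply: DP.
  apply: (@allpairs_f _ _ _ (fun i xy => c i [~ xy.1, xy.2]%g) _ _ i (x, y)).
    by rewrite mem_enum.
  by apply: allpairs_f; exact: Ss.
(* Here the first argument is reduced to generators; exchanging the arguments then falls back on
   [Zc1]. *)
have Zc i x y : Z (D%:R * c i [~ x, y]%g).
  move: x; apply: (genP _ (sg_comm i y)) => x Sx /=.
  by rewrite -invgR cV mulrN; apply: ZN; exact: Zc1.
(* The factor 2 absorbs the half in front of the commutator term. *)
exists (2 * D * E)%N => [|i]; first by rewrite !muln_gt0 D0.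
apply: (genP [set x | Z ((2 * D * E)%:R * c i x)]); last first.
  move=> x Sx /=; rewrite natrM -mulrA; apply/ZM/EP.
  by apply: allpairs_f; [rewrite mem_enum|exact: Ss].
split=> /= [|x y Zx Zy|x Zx]; first by rewrite c1 mulr0.
- rewrite qc // !mulrDr; apply: (ZD); first exact: ZD.
  have -> : (2 * D * E)%:R * (c i [~ x, y]%g / 2) =
      E%:R * (D%:R * c i [~ x, y]%g).
    by rewrite !natrM; field.
  exact/ZM/Zc.
- by rewrite cV mulrN; exact: ZN.
Qed.

(** * Affine isometries of the quotient *)

Lemma cV_comb_sum (R : nzRingType) (V : lmodType R) n (f : 'cV[R]_n -> V) :
  (forall k x y, f (k *: x + y) = k *: f x + f y) ->
  forall x, f x = \sum_j x j 0 *: f (delta_mx j 0).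
Proof.
move=> fC x.
have f0 : f 0 = 0 by have := fC (-1) 0 0; rewrite scaler0 addr0 scaleN1r addNr.
have {1}-> : x = \sum_j x j 0 *: delta_mx j 0.
  by rewrite {1}[x]matrix_sum_delta; apply: eq_bigr => j _; rewrite big_ord1.
by elim/big_rec2: _ => [|j v w _ <-].
Qed.

Lemma matrix_eq_mulmx (R : pzRingType) m n (M N : 'M[R]_(m, n)) :
  (forall x : 'cV_n, M *m x = N *m x) -> M = N.
Proof.
move=> MN; apply/matrixP => i j; have /matrixP/(_ i 0) := MN (delta_mx j 0).
by rewrite -!colE !mxE.
Qed.

Lemma mx_entry_le_norm (R : realDomainType) m k (A : 'M[R]_(m, k)) i j :
  `|A i j| <= `|A|.
Proof.
rewrite [leRHS]/Num.norm /= mx_normrE.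
by apply/bigmax_geP; right => /=; exists (i, j).
Qed.

Section AffineMaps.
Variables (R : realType) (d : nat) (B : 'M[R]_d).
Implicit Types (f : affine_isometry B) (A : 'M[R]_d).

Lemma mulmx_continuous A : continuous (mulmx A : 'cV[R]_d -> 'cV[R]_d).
Proof.
have -> : mulmx A = \sum_j (fun x : 'cV[R]_d => x j 0 *: col j A).
  apply/funext => x; apply/matrixP => i k; rewrite fct_sumE mxE summxE.
  by apply: eq_bigr => j _; rewrite !mxE (ord1 k) mulrC.
move=> x; apply: differentiable_continuous; apply: differentiable_sum => j.
by apply: differentiableZl; exact: differentiable_coord.
Qed.

Lemma differentiable_affine_map f (u : 'cV[R]_d) : differentiable (affine_map f) u.
Proof.
apply: differentiableD; last exact: differentiable_cst.
exact/linear_differentiable/mulmx_continuous.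
Qed.

Lemma diff_affine_map f (u v : 'cV[R]_d) : 
  'd (affine_map f) u v = linear_part f *m v.
Proof.
pose A := linear_part f; have cA := @mulmx_continuous A.
have dA : is_diff u (mulmx A) (mulmx A).
  exact: DiffDef (linear_differentiable _ cA) (diff_lin _ cA).
have dc : is_diff u (cst (translation_part f)) (0 : 'cV[R]_d -> 'cV[R]_d).
  exact: is_diff_cst.
have dAc := is_diffD dA dc.
have -> : affine_map f = mulmx A + cst (translation_part f) by [].
by rewrite (diff_val (is_diff_def := dAc)) /= addr0.
Qed.

Lemma class_C_cst (V W : normedModType R) k (U : set V) (w : W) :
  class_C k U (cst w).
Proof.
elim: k w => [|k IH] w /=; first by move=> x _; exact: cst_continuous.
split=> [x _|v]; first exact: differentiable_cst.
have -> : 'D_v (cst w : V -> W) = cst 0 by apply/funext => x; rewrite derive_cst.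
exact: IH.
Qed.

Lemma affine_map_smooth f (U : set 'cV[R]_d) : smooth_on U (affine_map f).
Proof.
case=> [|k] /=.
  by move=> x _; exact/differentiable_continuous/differentiable_affine_map.
split=> [x _|v]; first exact: differentiable_affine_map.
have -> : 'D_v (affine_map f) = cst (linear_part f *m v).
  apply/funext => x; rewrite deriveE ?diff_affine_map //.
  exact: differentiable_affine_map.
exact: class_C_cst.
Qed.

Lemma form_linear_part f (a b : 'cV[R]_d) :
  Defs.form B (linear_part f *m a) (linear_part f *m b) = Defs.form B a b.
Proof.
rewrite /Defs.form trmx_mul -!mulmxA (mulmxA B) (mulmxA _^T (B *m _)).
by rewrite (mulmxA _^T B) linear_part_form.
Qed.

Variables (G : groupType) (rho : {multiplicative G -> affine_isometry B}).

Lemma orbit_projP x y : orbit_proj rho x = orbit_proj rho y <->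
  exists g : G, affine_map (rho g) x = y.
Proof.
split=> [|xy]; first by move/(eqmodP (orbit_equiv_rel rho)) => /asboolP.
by apply/(eqmodP (orbit_equiv_rel rho)); apply/asboolP.
Qed.

Definition orbit_map f (p : orbit_space rho) : orbit_space rho :=
  orbit_proj rho (affine_map f (repr p)).

Lemma orbit_proj_repr p : orbit_proj rho (repr p) = p.
Proof. exact: reprK. Qed.

(** The chosen representative differs from x by some [rho g], which commutes with [f]. *)
Lemma orbit_mapE f x : (forall g, (f * rho g = rho g * f)%g) ->
  orbit_map f (orbit_proj rho x) = orbit_proj rho (affine_map f x).
Proof.
move=> fC; have /orbit_projP[g e] := orbit_proj_repr (orbit_proj rho x).
by apply/orbit_projP; exists g; rewrite -affine_mapM -fC affine_mapM e.
Qed.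

Lemma orbit_map_preserves_metric f : (forall g, (f * rho g = rho g * f)%g) ->
  preserves_metric (orbit_map f).
Proof.
move=> fC x; exists setT, (affine_map f); split=> //.
- exact: openT.
- exact: affine_map_smooth.
- by move=> u _; rewrite orbit_mapE.
- by move=> u a b _; rewrite !diff_affine_map form_linear_part.
Qed.

Lemma orbit_map_isometry f : (forall g, (f * rho g = rho g * f)%g) ->
  quotient_isometry (orbit_map f).
Proof.
move=> fC; have fVC g : (f^-1 * rho g = rho g * f^-1)%g.
  by apply/commute_sym/commuteV/commute_sym/fC.
split; first exact: orbit_map_preserves_metric.
exists (orbit_map f^-1%g); split; last exact: orbit_map_preserves_metric.
- move=> p; rewrite -[p]orbit_proj_repr !orbit_mapE //.
  by rewrite -affine_mapM mulVg affine_map1.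
- move=> p; rewrite -[p]orbit_proj_repr !orbit_mapE //.
  by rewrite -affine_mapM mulgV affine_map1.
Qed.

End AffineMaps.

(** * Groups of translations *)

Section LieAlgebraTranslations.
Variables (R : realType) (d : nat) (B : 'M[R]_d).
Variable ad : 'cV[R]_d -> 'M[R]_d.
Hypothesis ad_comb : forall k u v, ad (k *: u + v) = k *: ad u + ad v.
Hypothesis ad_anti : forall u v, ad u *m v = - (ad v *m u).
Hypothesis ad_mul : forall u v, ad u *m ad v = 0.
Hypothesis ad_skew : forall u, (ad u)^T *m B = - (B *m ad u).
Implicit Types u v w x y z : 'cV[R]_d.

Lemma ad0 : ad 0 = 0.
Proof. by have := ad_comb (-1) 0 0; rewrite scaler0 addr0 scaleN1r addNr. Qed.

Lemma adD u v : ad (u + v) = ad u + ad v.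
Proof. by rewrite -[u]scale1r ad_comb !scale1r. Qed.

Lemma adZ k u : ad (k *: u) = k *: ad u.
Proof. by rewrite -[k *: u]addr0 ad_comb ad0 addr0. Qed.

Lemma ad_self u : ad u *m u = 0.
Proof.
apply/matrixP => i j; have /matrixP/(_ i j) := ad_anti u u.
by rewrite !mxE; lra.
Qed.

(** By antisymmetry [[u, v], w] = - [w, [u, v]], a product of two [ad] applied to v. *)
Lemma ad_ad u v : ad (ad u *m v) = 0.
Proof.
by apply: matrix_eq_mulmx => w; rewrite (ad_anti _ w) mulmxA ad_mul !mul0mx oppr0.
Qed.

(** Since [ad u] squares to zero, 1 - k ad u is the inverse; skewness cancels the terms linear in
    k. *)
Lemma translation_preserves_form k u : preserves_form B (1%:M + k *: ad u, u).1.
Proof.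
rewrite /preserves_form /=; apply/andP; split.
  apply: (proj1 (@mulmx1_unit _ _ _ (1%:M - k *: ad u) _)).
  rewrite mulmxBr mulmx1 -scalemxAr mulmxDl mul1mx -scalemxAl ad_mul.
  by rewrite scaler0 addr0 addrK.
have -> : (1%:M + k *: ad u)^T = 1%:M + k *: (ad u)^T.
  by rewrite linearD linearZ /= trmx1.
apply/eqP; rewrite mulmxDl mul1mx -scalemxAl ad_skew.
rewrite mulmxDr mulmx1 mulmxDl -!scalemxAr -!scalemxAl mulNmx -mulmxA ad_mul.
by rewrite mulmx0 oppr0 !scaler0 addr0 scalerN addrNK.
Qed.

(* For k = 1/2 and k = -1/2 these are the left and the right translations of the
   simply connected group with Lie algebra 'cV[R]_d, in logarithmic coordinates. *)
Definition translation k u : affine_isometry B :=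
  AffineIsometry (translation_preserves_form k u).

Lemma translationE k u x :
  affine_map (translation k u) x = x + k *: (ad u *m x) + u.
Proof.
by rewrite /affine_map /linear_part /translation_part /= mulmxDl mul1mx -scalemxAl.
Qed.

Lemma translation_comp k l u v : linear_part (translation k u * translation l v)%g =
  1%:M + k *: ad u + l *: ad v.
Proof.
rewrite /linear_part /= mulmxDl mul1mx mulmxDr mulmx1 -scalemxAl -scalemxAr ad_mul.
by rewrite !scaler0 addr0 addrAC.
Qed.

Lemma translationM k u v :
  (translation k u * translation k v)%g = translation k (u + v + k *: (ad u *m v)).
Proof.
apply: affine_isometry_eq.
  rewrite translation_comp /linear_part /= !adD adZ ad_ad scaler0 addr0.
  by rewrite scalerDr addrA.
by rewrite /translation_part /= mulmxDl mul1mx -scalemxAl addrC addrA.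
Qed.

Lemma translationC k u v :
  (translation k u * translation (- k) v = translation (- k) v * translation k u)%g.
Proof.
apply: affine_isometry_eq; first by rewrite !translation_comp addrAC.
rewrite /translation_part /= /linear_part /= !mulmxDl !mul1mx -!scalemxAl.
rewrite (ad_anti v u) scalerN scaleNr opprK addrAC [RHS]addrAC.
by congr (_ + _); rewrite addrC.
Qed.

(** Brackets are annihilated by [ad], so ad z = ad y + ad u and [z, y] = [u, y]. *)
Lemma translation_solve k u y z :
  affine_map (translation k u) y = z -> u = z - y - k *: (ad z *m y).
Proof.
rewrite translationE => <-; rewrite !adD adZ ad_ad scaler0 addr0 mulmxDl.
by rewrite ad_self add0r (addrAC _ u) [y + _]addrC addrK [_ + u]addrC addrK.
Qed.

(** * The action of a discrete group by left translations *)

Variables (G : groupType) (L : G -> 'cV[R]_d).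
Hypothesis LM : forall g h, L (g * h)%g = L g + L h + 2^-1 *: (ad (L g) *m L h).
Hypothesis L_eq0 : forall g, L g = 0 -> g = 1%g.
Hypothesis L_discrete : forall N : R,
  finite_set [set g | forall i, `|L g i 0| <= N].

Definition left_translation g := translation 2^-1 (L g).

Lemma left_translationM g h :
  left_translation (g * h)%g = (left_translation g * left_translation h)%g.
Proof. by rewrite /left_translation translationM LM. Qed.

HB.instance Definition _ := isMultiplicative.Build G (affine_isometry B)
  left_translation left_translationM.

Lemma left_translation_inj : injective left_translation.
Proof.
move=> g h gh; apply/divg1_eq/L_eq0.
have : left_translation (g / h)%g = 1%g.
  by rewrite left_translationM gh -left_translationM mulgV; exact: rho1.
by move/(congr1 (@translation_part R d B)).
Qed.

Lemma left_translation_free : acts_freely left_translation.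
Proof.
move=> _ x [g _ <-] /translation_solve; rewrite subrr sub0r.
by rewrite ad_self scaler0 oppr0 => /L_eq0 ->; exact: rho1.
Qed.

Lemma left_translation_holonomy : abelian_holonomy left_translation.
Proof.
move=> _ _ [_ [g _ <-] <-] [_ [h _ <-] <-].
by rewrite /linear_part /= !(mulmxDl, mulmxDr) !mul1mx !mulmx1 -!scalemxAl
  -!scalemxAr !ad_mul !scaler0 !addr0 -addrA [X in _ + X]addrC addrA addrAC.
Qed.

Lemma left_translation_homogeneous : homogeneous_quotient left_translation.
Proof.
move=> p q; pose x := repr p; pose y := repr q.
(* This is [translation_solve] for k = -1/2: the right translation by w sends x to y. *)
pose w := y - x - 2^-1 *: (ad x *m y).
pose f := translation (- 2^-1) w.
have fC g : (f * left_translation g = left_translation g * f)%g.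
  by rewrite [RHS]translationC.
exists (@orbit_map _ _ _ _ left_translation f); first exact: orbit_map_isometry.
rewrite -[p]orbit_proj_repr orbit_mapE // -[q]orbit_proj_repr -/x -/y.
congr (orbit_proj _ _).
rewrite translationE ad_anti scaleNr scalerN opprK.
rewrite /w mulmxBr mulmxBr ad_self subr0 -scalemxAr mulmxA.
rewrite ad_mul mul0mx scaler0 subr0.
by rewrite -(addrA y) -opprD [LHS]addrC subrK.
Qed.

Lemma ad_bounded (M : R) : exists N, forall u v,
  `|u| <= M -> `|v| <= M -> forall i, `|(ad u *m v) i 0| <= N.
Proof.
(* Summing over all rows i makes the bound uniform in the row. *)
exists (\sum_k \sum_i \sum_j M * `|ad (delta_mx j 0) i k| * M) => u v uM vM i.
have M0 : 0 <= M by exact: le_trans uM.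
rewrite mxE; apply: le_trans (ler_norm_sum _ _ _) _; apply: ler_sum => k _.
rewrite (bigD1 i) //=.
apply: (@le_trans _ _ (\sum_j M * `|ad (delta_mx j 0) i k| * M)).
  rewrite normrM -mulr_suml; apply: ler_pM => //; last first.
    exact: le_trans (mx_entry_le_norm _ _ _) vM.
  rewrite (cV_comb_sum ad_comb) summxE; apply: le_trans (ler_norm_sum _ _ _) _.
  apply: ler_sum => j _; rewrite mxE normrM; apply: ler_wpM2r => //.
  exact: le_trans (mx_entry_le_norm _ _ _) uM.
rewrite lerDl; apply: sumr_ge0 => l _; apply: sumr_ge0 => j _.
by rewrite !mulr_ge0.
Qed.

(** If g moves y in K to z in K, then L g = z - y - [z, y] / 2 is bounded in terms of K, and only
    finitely many g qualify. *)
Lemma left_translation_discontinuous :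
  acts_properly_discontinuously left_translation.
Proof.
move=> K /compact_bounded[M0 [_ /(_ (M0 + 1)%R)]].
rewrite ltrDl ltr01 => /(_ isT) KM.
pose M := M0 + 1; have [N adN] := ad_bounded M.
apply: sub_finite_set
  (finite_image left_translation (L_discrete (M + M + 2^-1 * N))).
move=> _ [[g _ <-] [z [[y Ky yz] Kz]]]; exists g => //= i.
rewrite (translation_solve yz) !mxE.
have := adN z y (KM _ Kz) (KM _ Ky) i; rewrite mxE => zyN.
rewrite (le_trans (ler_normB _ _)) // lerD //.
  rewrite (le_trans (ler_normB _ _)) // lerD //.
    exact: le_trans (mx_entry_le_norm _ _ _) (KM _ Kz).
  exact: le_trans (mx_entry_le_norm _ _ _) (KM _ Ky).
by rewrite normrM ger0_norm ?ler_wpM2l // invr_ge0.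
Qed.

Lemma homogeneous_representation_exists :
  exists rho : {multiplicative G -> affine_isometry B},
    [/\ injective rho, complete_flat_homogeneous rho & abelian_holonomy rho].
Proof.
exists left_translation.
split; [exact: left_translation_inj| |exact: left_translation_holonomy].
split; [exact: left_translation_free|exact: left_translation_discontinuous|].
exact: left_translation_homogeneous.
Qed.

End LieAlgebraTranslations.

(** * Cotangent extension of a Lie algebra *)

Section CotangentLieAlgebra.
Variables (R : fieldType) (n : nat) (a : 'cV[R]_n -> 'M[R]_n).
Hypothesis a_comb : forall k x y, a (k *: x + y) = k *: a x + a y.
Hypothesis a_anti : forall x y, a x *m y = - (a y *m x).
Hypothesis a_mul : forall x y, a x *m a y = 0.
Implicit Types (x y : 'cV[R]_n) (u v : 'cV[R]_(n + n)).

(** The bracket of the dual element f with y is the transpose of [a y] applied to f; this is its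
    matrix as a linear map in y. *)
Definition coad (f : 'cV[R]_n) : 'M[R]_n :=
  \matrix_(i, j) ((a (delta_mx j 0))^T *m f) i 0.

Lemma coadE f y : coad f *m y = (a y)^T *m f.
Proof.
apply/matrixP => i k; rewrite (ord1 k) [in RHS](cV_comb_sum a_comb y).
rewrite linear_sum mulmx_suml summxE mxE.
by apply: eq_bigr => j _; rewrite linearZ -scalemxAl !mxE mulrC.
Qed.

(** The bilinear form of [coad f] is f evaluated on brackets, which are antisymmetric. *)
Lemma coad_skew f : (coad f)^T = - coad f.
Proof.
apply/matrixP => i j; rewrite !mxE -sumrN; apply: eq_bigr => k _; rewrite !mxE.
have /matrixP/(_ k 0) := a_anti (delta_mx i 0) (delta_mx j 0).
by rewrite -!colE !mxE => ->; rewrite mulNr.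
Qed.

Lemma coad_comb k f g : coad (k *: f + g) = k *: coad f + coad g.
Proof. by apply/matrixP => i j; rewrite [LHS]mxE mulmxDr -scalemxAr !mxE. Qed.

Lemma a_mulmx_eq0 x y : a (a x *m y) = 0.
Proof.
by apply: matrix_eq_mulmx => z; rewrite (a_anti _ z) mulmxA a_mul !mul0mx oppr0.
Qed.

(* The semidirect product of the Lie algebra with its dual, acting by the
   coadjoint representation. *)
Definition cotangent_ad u : 'M[R]_(n + n) :=
  block_mx (a (usubmx u)) 0 (coad (dsubmx u)) (- (a (usubmx u))^T).

Definition pairing_form : 'M[R]_(n + n) := block_mx 0 1%:M 1%:M 0.

Lemma cotangent_ad_comb k u v :
  cotangent_ad (k *: u + v) = k *: cotangent_ad u + cotangent_ad v.
Proof.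
rewrite /cotangent_ad scale_block_mx add_block_mx !linearP a_comb coad_comb.
by rewrite scaler0 addr0 linearP /= opprD scalerN.
Qed.

Lemma cotangent_adE u v : cotangent_ad u *m v =
  col_mx (a (usubmx u) *m usubmx v)
         (coad (dsubmx u) *m usubmx v - (a (usubmx u))^T *m dsubmx v).
Proof. by rewrite -{1}[v]vsubmxK mul_block_col mul0mx addr0 mulNmx. Qed.

Lemma cotangent_ad_anti u v : cotangent_ad u *m v = - (cotangent_ad v *m u).
Proof.
by rewrite !cotangent_adE opp_col_mx -a_anti !coadE opprB.
Qed.

Lemma cotangent_ad_mul u v : cotangent_ad u *m cotangent_ad v = 0.
Proof.
rewrite /cotangent_ad mulmx_block !mul0mx !mulmx0 !addr0 !add0r !mulNmx.
rewrite !mulmxN opprK.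
rewrite -trmx_mul !a_mul trmx0.
(* Both sides vanish: applied to z, each is the transpose of a zero matrix applied to a dual
   vector. *)
suff -> : coad (dsubmx u) *m a (usubmx v) = (a (usubmx u))^T *m coad (dsubmx v).
  by rewrite subrr -block_mx0.
apply: matrix_eq_mulmx => z.
rewrite -!mulmxA !coadE a_mulmx_eq0 trmx0 mul0mx mulmxA -trmx_mul a_mul.
by rewrite trmx0 mul0mx.
Qed.

Lemma cotangent_ad_skew u :
  (cotangent_ad u)^T *m pairing_form = - (pairing_form *m cotangent_ad u).
Proof.
rewrite /cotangent_ad /pairing_form tr_block_mx !mulmx_block.
rewrite !mulmx0 !mul0mx !mulmx1 !mul1mx !add0r !addr0 coad_skew trmx0.
by rewrite linearN /= trmxK opp_block_mx opprK oppr0.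
Qed.

End CotangentLieAlgebra.

Lemma pairing_form_unit (R : realType) n : pairing_form R n \in unitmx.
Proof.
apply: (proj1 (@mulmx1_unit _ _ _ (pairing_form R n) _)).
by rewrite /pairing_form mulmx_block !mulmx0 !mul0mx !mulmx1 !add0r !addr0
  -scalar_mx_block.
Qed.

Lemma neutral_form_hyperbolic (R : realType) n (B : 'M[R]_(n + n)) :
  @has_signature R n n B ->
  exists2 Q, Q \in unitmx & Q^T *m B *m Q = pairing_form R n.
Proof.
move=> [_ _ [P uP PBP]].
(* For basis vectors p of square 1 and q of square -1, the vectors p + q and (p - q) / 2 are
   isotropic with product 1. *)
pose C : 'M[R]_(n + n) := block_mx 1%:M (2^-1)%:M 1%:M (- (2^-1)%:M).
have QBQ : (P *m C)^T *m B *m (P *m C) = pairing_form R n.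
  rewrite trmx_mul -!mulmxA (mulmxA B) (mulmxA P^T) (mulmxA P^T) PBP.
  rewrite /C tr_block_mx !mulmx_block !tr_scalar_mx.
  have -> : (- (2^-1)%:M)^T = - (2^-1)%:M :> 'M[R]_n.
    by rewrite linearN /= tr_scalar_mx.
  rewrite !(mul0mx, mulmx1, mul1mx, mulNmx, mulmxN, opprK, addr0, add0r, oppr0).
  rewrite !subrr -raddfD /=; congr (block_mx _ _%:M _%:M _); lra.
exists (P *m C) => //.
have := pairing_form_unit R n; by rewrite -QBQ unitmx_mul => /andP[_].
Qed.

(** * The real Malcev Lie algebra *)

Section MalcevLieAlgebra.
Variables (R : realType) (G : groupType) (n : nat).
Variables (e : 'I_n -> G) (c : 'I_n -> G -> rat).
Hypothesis comm_central : forall x y z : G, commute [~ x, y]%g z.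
Hypothesis qc : forall i, quasi_additive setT (c i).
Hypothesis cE : forall f, quasi_additive setT f ->
  forall x, f x = \sum_i f (e i) * c i x.
Hypothesis c_inj : forall x, (forall i, c i x = 0) -> x = 1%g.
Implicit Types (g h : G) (x y : 'cV[R]_n).

Let sgG : is_subgroup [set: G]. Proof. by []. Qed.

Let c1 i : c i 1%g = 0. Proof. exact: quasi_additive1 (qc i). Qed.

Let cD i g h : commute g h -> c i (g * h)%g = c i g + c i h.
Proof. exact: (quasi_additiveD sgG (qc i)). Qed.

(** Commutation with h is a homomorphism into the centre that kills commutators, so the half term
    vanishes. *)
Lemma comm_quasi_additivel i h : quasi_additive setT (fun g => c i [~ g, h]%g).
Proof.
by move=> x y _ _; rewrite commMg // cD // commg_commg // c1 mul0r addr0.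
Qed.

Lemma comm_quasi_additiver i g : quasi_additive setT (fun h => c i [~ g, h]%g).
Proof.
move=> x y _ _; rewrite commgM // cD //.
rewrite (_ : [~ g, [~ x, y]]%g = 1%g) ?c1 ?mul0r ?addr0 //.
by apply/eqP/commgP/commute_sym.
Qed.

Lemma comm_coordinates i g h :
  c i [~ g, h]%g = \sum_j \sum_k c i [~ e j, e k]%g * c j g * c k h.
Proof.
rewrite (cE (comm_quasi_additivel i h)); apply: eq_bigr => j _.
rewrite (cE (comm_quasi_additiver i (e j))) mulr_suml.
by apply: eq_bigr => k _; rewrite mulrAC.
Qed.

Definition malcev_log g : 'cV[R]_n := \col_i ratr (c i g).

(** The structure constants of the Lie algebra are the coordinates of the commutators of the
    [e i]. *)
Definition malcev_ad x : 'M[R]_n :=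
  \matrix_(k, j) \sum_i x i 0 * ratr (c k [~ e i, e j]%g).

Lemma malcev_ad_comb (k : R) x y :
  malcev_ad (k *: x + y) = k *: malcev_ad x + malcev_ad y.
Proof.
apply/matrixP => i j; rewrite !mxE mulr_sumr -big_split /=.
by apply: eq_bigr => l _; rewrite !mxE mulrDl mulrA.
Qed.

Lemma malcev_ad_anti x y : malcev_ad x *m y = - (malcev_ad y *m x).
Proof.
apply/matrixP => k l; rewrite (ord1 l) !mxE.
under eq_bigr do rewrite mxE mulr_suml.
rewrite exchange_big -sumrN; apply: eq_bigr => i _ /=.
rewrite mxE mulr_suml -sumrN; apply: eq_bigr => j _.
rewrite -[[~ e i, e j]%g]invgR (quasi_additiveV sgG (qc k)) // rmorphN /=; ring.
Qed.

Lemma malcev_adE g h :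
  malcev_ad (malcev_log g) *m malcev_log h = malcev_log [~ g, h]%g.
Proof.
apply/matrixP => k l; rewrite (ord1 l) !mxE comm_coordinates rmorph_sum /=.
under eq_bigr do rewrite !mxE mulr_suml.
rewrite exchange_big; apply: eq_bigr => i _ /=.
rewrite rmorph_sum; apply: eq_bigr => j _ /=.
by rewrite mxE !rmorphM /= (mulrC (ratr (c i g))).
Qed.

Lemma malcev_ad_mul x y : malcev_ad x *m malcev_ad y = 0.
Proof.
apply/matrixP => k l; rewrite !mxE.
have -> : \sum_j malcev_ad x k j * malcev_ad y j l = \sum_i \sum_m
    x i 0 * y m 0 * ratr (\sum_j c k [~ e i, e j]%g * c j [~ e m, e l]%g).
  under eq_bigr do rewrite !mxE mulr_suml.
  rewrite exchange_big; apply: eq_bigr => i _ /=.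
  under eq_bigr do rewrite mulr_sumr.
  rewrite exchange_big; apply: eq_bigr => m _ /=.
  rewrite rmorph_sum mulr_sumr; apply: eq_bigr => j _ /=.
  by rewrite rmorphM; ring.
(* By [cE], the sum over j is a coordinate of the triple commutator [e i, [e m, e l]], which is
   trivial. *)
rewrite big1 // => i _; rewrite big1 // => m _.
rewrite -(cE (comm_quasi_additiver k (e i))).
rewrite (_ : [~ e i, [~ e m, e l]]%g = 1%g) ?c1 ?rmorph0 ?mulr0 //.
by apply/eqP/commgP/commute_sym.
Qed.

Lemma malcev_logM g h : malcev_log (g * h)%g =
  malcev_log g + malcev_log h +
  2^-1 *: (malcev_ad (malcev_log g) *m malcev_log h).
Proof.
rewrite malcev_adE; apply/matrixP => i j; rewrite !mxE qc // !rmorphD /=.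
by rewrite rmorphM /= fmorphV /= rmorph_nat mulrC.
Qed.

Lemma malcev_log_eq0 g : malcev_log g = 0 -> g = 1%g.
Proof.
move=> /matrixP g0; apply: c_inj => i; apply: (fmorph_inj (@ratr R)).
by have := g0 i 0; rewrite !mxE rmorph0.
Qed.

(** Coordinates of commutators depend only on those of the arguments, so [g, h] has those of [h, h]
    = 1, and the coordinates of g / h vanish. *)
Lemma coordinates_inj g h : (forall i, c i g = c i h) -> g = h.
Proof.
move=> gh; apply/divg1_eq/c_inj => i; rewrite qc //.
have cV k : c i (k^-1)%g = - c i k by exact: (quasi_additiveV sgG (qc i)).
have -> : c i [~ g, h^-1]%g = 0.
  rewrite -invgR commVg // !cV opprK -[RHS](c1 i) -(commgg h) !comm_coordinates.
  by apply: eq_bigr => j _; apply: eq_bigr => k _; rewrite gh.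
by rewrite mul0r addr0 cV gh subrr.
Qed.

Variables (D : nat).
Hypothesis D_gt0 : (0 < D)%N.
Hypothesis D_int : forall i g, exists a : int, D%:R * c i g = a%:~R.

Lemma malcev_log_discrete (N : R) :
  finite_set [set g | forall i, `|malcev_log g i 0| <= N].
Proof.
have /choice[z zE] : forall g, exists z : 'I_n -> int, forall i,
    D%:R * c i g = (z i)%:~R.
  by move=> g; have /choice[z zE] := (D_int)^~ g; exists z.
(* The integers D c_i(g) lie between -K and K; the shift by K codes them in 0, ..., 2K, where
   [inord] is faithful. *)
pose K := (Num.truncn (D%:R * N)).+1.
pose code g : {ffun 'I_n -> 'I_(2 * K).+1} :=
  [ffun i => inord (absz (z g i + K%:Z))].
have Nz g i : `|malcev_log g i 0| <= N -> (absz (z g i) <= K)%N.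
  rewrite mxE => gN; rewrite -(ler_nat R) natr_absz intr_norm.
  have -> : (z g i)%:~R = D%:R * ratr (c i g) :> R.
    by rewrite -(ratr_nat R D) -rmorphM /= zE ratr_int.
  rewrite normrM normr_nat; apply: le_trans (ltW (truncnS_gt _)).
  by rewrite ler_wpM2l.
have code_inj :
    {in [set g | forall i, `|malcev_log g i 0| <= N] &, injective code}.
  move=> g h /set_mem gN /set_mem hN gh; apply: coordinates_inj => i.
  have D0 : D%:R != 0 :> rat by rewrite pnatr_eq0 -lt0n.
  apply: (mulfI D0); rewrite !zE; congr (_%:~R).
  move/ffunP/(_ i)/(congr1 val): gh; rewrite !ffunE /=.
  have := Nz _ _ (gN i); have := Nz _ _ (hN i) => hK gK.
  rewrite !inordK; lia.
rewrite -(eq_finite_set (inj_card_eq code_inj)); exact: finite_finset.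
Qed.

End MalcevLieAlgebra.

(** * Assembling the representation *)

Lemma two_step_nilpotent_commute (G : groupType) : two_step_nilpotent G ->
  forall x y z : G, commute [~ x, y]%g z.
Proof.
move=> nG x y z; apply/commute_sym/commgP/eqP.
suff : commutator_subgroup setT (commutator_subgroup setT setT)
    [~ z, [~ x, y]]%g.
  by rewrite nG.
apply: sub_generated; exists z, [~ x, y]%g; split=> //.
by apply: sub_generated; exists x, y.
Qed.

Theorem theorem5p1 (R : realType) (n : nat) (B : 'M[R]_(n + n)) (G : groupType) :
  @has_signature R n n B ->
  finitely_generated G -> torsion_free G -> two_step_nilpotent G ->
  has_hirsch_length G n ->
  exists rho : {multiplicative G -> affine_isometry B},
    [/\ injective rho, complete_flat_homogeneous rho & abelian_holonomy rho].
Proof.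
move=> /neutral_form_hyperbolic[Q uQ QBQ] fgG tfG nG hG.
have cc := two_step_nilpotent_commute nG.
have [e [c [qc cE c_inj]]] := log_coordinates_exist cc tfG hG.
have [D D0 D_int] := common_denominator cc fgG qc.
pose a := @malcev_ad R G n e c; pose l := @malcev_log R G n c.
have a_comb := @malcev_ad_comb R G n e c.
have a_anti : forall x y, a x *m y = - (a y *m x) by exact: malcev_ad_anti.
have a_mul : forall x y, a x *m a y = 0 by exact: malcev_ad_mul.
(* The cotangent Lie algebra is transported along [Q] from the pairing form to [B]; [G] enters with
   zero dual component. *)
pose ad u := Q *m cotangent_ad a (invmx Q *m u) *m invmx Q.
pose L g := Q *m col_mx (l g) 0.
have LE g : invmx Q *m L g = col_mx (l g) 0 by rewrite mulKmx.
have lE g : l g = usubmx (invmx Q *m L g) by rewrite LE col_mxKu.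
apply: (@homogeneous_representation_exists R _ B ad _ _ _ _ G L).
- move=> k u v; rewrite /ad mulmxDr -scalemxAr cotangent_ad_comb //.
  by rewrite mulmxDr mulmxDl -scalemxAr -scalemxAl.
- move=> u v; rewrite /ad -!mulmxA cotangent_ad_anti //.
  by rewrite mulmxN.
- move=> u v; rewrite /ad -!mulmxA (mulmxA (invmx Q) Q) mulVmx // mul1mx.
  by rewrite (mulmxA (cotangent_ad a _)) cotangent_ad_mul // mul0mx mulmx0.
- move=> u; have BE : B = (invmx Q)^T *m pairing_form R n *m invmx Q.
    rewrite -QBQ !mulmxA -trmx_mul mulmxV // trmx1 mul1mx -mulmxA mulmxV //.
    by rewrite mulmx1.
  rewrite /ad [in LHS]BE [in RHS]BE !trmx_mul -!mulmxA.
  rewrite (mulmxA Q^T) -trmx_mul mulVmx // trmx1 mul1mx (mulmxA (invmx Q) Q).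
  rewrite mulVmx // mul1mx (mulmxA (cotangent_ad a _)^T) cotangent_ad_skew //.
  by rewrite mulNmx mulmxN -!mulmxA.
- move=> g h; rewrite /ad LE /L -!mulmxA mulKmx //.
  rewrite cotangent_adE !col_mxKu !col_mxKd /l (malcev_logM R cc qc cE) -/a -/l.
  rewrite (scalemxAr _ Q) -!mulmxDr (coadE a_comb) !mulmx0 subr0.
  by rewrite scale_col_mx !add_col_mx scaler0 !addr0.
- move=> g L0; apply: (malcev_log_eq0 (R := R) c_inj).
  by rewrite -/(l g) lE L0 mulmx0 linear0.
(* Summing over all rows of the inverse of [Q] bounds every coordinate of [l g] at once. *)
- move=> N; pose M := \sum_k \sum_j `|invmx Q k j| * N.
  apply: sub_finite_set (malcev_log_discrete cc qc cE c_inj D0 D_int M) => g.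
  move=> gN i.
  rewrite -/(l g) lE mxE mxE; apply: le_trans (ler_norm_sum _ _ _) _.
  rewrite /M [leRHS](bigD1 (lshift n i)) //=; apply: ler_wpDr.
    apply: sumr_ge0 => k _; apply: sumr_ge0 => j _; apply: mulr_ge0 => //.
    exact: le_trans (gN j).
  by apply: ler_sum => j _; rewrite normrM ler_wpM2l.
Qed.
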